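(* Let $N=p^2q^2$ where $p<q$ are primes. Then $N$ satisfies the ISAP.
   Context: **ISAP.** For a positive integer $N$ and a set $D$ of divisors $d$ of $N$ with $1\le d<N$, let $ICG_N(D)$ be the graph on vertex set $\mathbb{Z}/N\mathbb{Z}$ in which $i,j$ are adjacent iff $\gcd(i-j,N)\in D$. (These are exactly the integral circulant graphs of order $N$; $D$ is the integral symbol.) The spectrum of a graph is the multiset of eigenvalues of its adjacency matrix. $N$ satisfies the integral spectral Ádám property (ISAP) if for any two such sets $D,D'$, the graphs $ICG_N(D)$ and $ICG_N(D')$ have the same spectrum if and only if $D=D'$. *)

(* Defs.v *)
From mathcomp Require Import all_boot all_order all_algebra all_field.
From mathcomp Require Import finmap multiset.

Set Implicit Arguments.
Unset Strict Implicit.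
Unset Printing Implicit Defensive.

Import GRing.Theory.

Local Open Scope mset_scope.

(* A graph on n vertices is given by its adjacency relation on 'I_n. *)

Definition adjacency_matrix (n : nat) (e : rel 'I_n) : 'M[algC]_n :=
  (\matrix_(i < n, j < n) (e i j)%:R)%R.

(* The eigenvalues of A with algebraic multiplicity: the chosen sequence r
   satisfies char_poly A = \prod_(z <- r) ('X - z%:P), char_poly A being monic;
   seq_mset forgets the order of r. *)
Definition eigenvalues (n : nat) (A : 'M[algC]_n) : {mset algC} :=
  seq_mset (sval (closed_field_poly_normal (char_poly A))).

Definition spectrum (n : nat) (e : rel 'I_n) : {mset algC} :=
  eigenvalues (adjacency_matrix e).

Definition integral_symbol (N : nat) (D : {fset nat}) : Prop :=
  forall d : nat, d \in D -> d %| N /\ 1 <= d < N.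

(* Vertices are the representatives 0, ..., N - 1 of Z/NZ: gcd(i - j, N) depends
   only on the residue classes of i and j. The subtraction is that of int. *)
Definition icg (N : nat) (D : {fset nat}) : rel 'I_N :=
  fun i j => gcdn (absz (i%:Z - j%:Z)%R) N \in D.

Arguments icg : clear implicits.

Lemma icg_sym (N : nat) (D : {fset nat}) : symmetric (icg N D).
Proof. by move=> i j; rewrite /icg distnC. Qed.

Lemma icg_irrefl (N : nat) (D : {fset nat}) :
  integral_symbol N D -> irreflexive (icg N D).
Proof.
move=> symD i; apply/negP; rewrite /icg subrr absz0 gcd0n => /symD [_].
by rewrite ltnn andbF.
Qed.

Definition ISAP (N : nat) : Prop :=
  forall D D' : {fset nat}, integral_symbol N D -> integral_symbol N D' ->
    (spectrum (icg N D) = spectrum (icg N D') <-> D = D').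

(* Main.v *)
(** Write [p^2 q^2 = N].  The eigenvalue of [ICG_N(D)] at [j] depends only on
    the orders [p^k] and [q^l] of the two primary parts of the character
    [m |-> z^(j m)], so the spectrum consists of nine values, with multiplicities
    [phi(p^k) phi(q^l)], that are linear in the 0/1 matrix [x] recording which
    [p^(2-i) q^(2-j)] belong to [D].  Averaging [t^2] over the spectrum gives the
    degree.  Modulo [q] the eigenvalues no longer depend on [l]; counting residues,
    with the residue of the degree already known, determines [x i 0 - x i 1]
    modulo [q], hence exactly because [q > 2].  For [p > 2] the same
    argument modulo [p] and the degree determine [x].  For [p = 2] the degree and
    the information modulo 2 leave only the last column of [x] ambiguous, and the
    third moment of the spectrum settles it. *)

Require Import Defs.
From mathcomp Require Import all_boot all_order all_algebra all_field.
From mathcomp Require Import finmap multiset zify ring.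

Set Implicit Arguments.
Unset Strict Implicit.
Unset Printing Implicit Defensive.
Import Order.TTheory GRing.Theory Num.Theory.

Local Open Scope ring_scope.

(** * Eigenvalues through Ramanujan sums, and their moments *)

(* In Z/p^2, the sum over the subgroup of order p^i of a character of order p^k. *)
Definition subgroup_sum (p : int) (k i : nat) : int :=
  if (k + i <= 2)%N then p ^+ i else 0.

(* The sum of such a character over the elements of order exactly p^i. *)
Definition ramanujan (p : int) (k i : nat) : int :=
  if i is i'.+1 then subgroup_sum p k i - subgroup_sum p k i' else 1.

Definition eigval (p q : int) (x : nat -> nat -> int) (k l : nat) : int :=
  \sum_(i < 3) \sum_(j < 3) x i j * (ramanujan p k i * ramanujan q l j).

(** For [p] prime, [ramanujan p 0 k] is the totient of [p ^ k], the number of characters of that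
    order; so this sums [f] over the spectrum with multiplicity. *)
Definition moment (p q : int) x (f : int -> int) : int :=
  \sum_(k < 3) \sum_(l < 3) ramanujan p 0 k * ramanujan q 0 l * f (eigval p q x k l).

Definition unroll := (big_ord_recl, big_ord0, lift0).

Lemma eigval_transpose p q x k l : eigval q p (fun i j => x j i) l k = eigval p q x k l.
Proof.
rewrite /eigval exchange_big; apply: eq_bigr => i _; apply: eq_bigr => j _.
by rewrite [X in _ * X]mulrC.
Qed.

Lemma moment_transpose p q x f :
  moment q p (fun i j => x j i) f = moment p q x f.
Proof.
rewrite /moment exchange_big; apply: eq_bigr => i _; apply: eq_bigr => j _.
by rewrite eigval_transpose [_ * ramanujan q 0 j]mulrC.
Qed.

(** Parseval: Ramanujan sums are orthogonal under these weights. For a 0/1 matrix the right side is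
    [p ^ 2 * q ^ 2] times the degree. *)
Lemma moment_sqr p q x : moment p q x (fun t => t ^+ 2) =
  p ^+ 2 * q ^+ 2 * eigval p q (fun i j => x i j ^+ 2) 0 0.
Proof.
rewrite /moment /eigval !unroll /= /subgroup_sum /=.
ring.
Qed.

(** * Eigenvalues modulo one of the primes *)

Definition col_diff (x : nat -> nat -> int) (i : nat) : int :=
  x i 0%N - x i 1%N.

Definition residue (p : int) x (k : nat) : int :=
  \sum_(i < 3) col_diff x i * ramanujan p k i.

Lemma dvdz_shift (q a b : int) : (q %| a - b)%Z ->
  forall c, (q %| a - c)%Z = (q %| b - c)%Z.
Proof. by move=> dab c; rewrite -(subrKA b) rpredDl. Qed.

(** Modulo [q], the sums [ramanujan q l j] for [j] = 0, 1, 2 are 1, -1, 0, whatever [l] is. *)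
Lemma eigval_residue p q x (k l : nat) : (k < 3)%N -> (l < 3)%N ->
  (q %| eigval p q x k l - residue p x k)%Z.
Proof.
move=> k3 l3; pose r (j : nat) : int :=
  if j is 0 then 1 else if j is 1 then -1 else 0.
have ramanujanE j : (j < 3)%N -> (q %| ramanujan q l j - r j)%Z.
  move=> j3; apply/dvdzP; case: j l j3 l3 => [|[|[|]]] // [|[|[|]]] //= _ _;
  rewrite /subgroup_sum /=; [
     by exists 0; ring | by exists 0; ring | by exists 0; ring
   | by exists 1; ring | by exists 1; ring | by exists 0; ring
   | by exists (q - 1); ring | by exists (-1); ring | by exists 0; ring ].
have -> : residue p x k = \sum_(i < 3) \sum_(j < 3) x i j * (ramanujan p k i * r j).
  by apply: eq_bigr => i _; rewrite /col_diff !unroll /r /=; ring.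
rewrite /eigval -sumrB; apply: rpred_sum => i _; rewrite -sumrB.
apply: rpred_sum => j _; rewrite -mulrBr -mulrBr !dvdz_mull //.
exact: ramanujanE.
Qed.

Lemma bits_eq (p : int) (b1 b2 c1 c2 : bool) : 1 < p ->
  (b1%:Z + p * b2%:Z = c1%:Z + p * c2%:Z) -> b1 = c1 /\ b2 = c2.
Proof. by case: b1; case: b2; case: c1; case: c2 => //=; lia. Qed.

(** With [f] the indicator of a residue class modulo [q], the moment counts the eigenvalues in that
    class. *)
Lemma residue_eq p q x x' : 1 < p -> 1 < q ->
  (forall f, moment p q x f = moment p q x' f) ->
  eigval p q x 0 0 = eigval p q x' 0 0 ->
  forall k, (k < 3)%N -> (q %| residue p x k - residue p x' k)%Z.
Proof.
move=> p1 q1 eqM eqdeg.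
have r0 : (q %| residue p x 0 - residue p x' 0)%Z.
  have := eigval_residue p q x (isT : 0 < 3)%N (isT : 0 < 3)%N.
  have := eigval_residue p q x' (isT : 0 < 3)%N (isT : 0 < 3)%N.
  by rewrite eqdeg => h h'; have := rpredB h h'; congr (dvdz _ _); ring.
(* Apart from the known k = 0, the residue classes k = 1, 2 have multiplicities in
   the ratio 1 : p, which tells them apart. *)
pose b y c k := (q %| residue p y k - c)%Z.
have momE y c : moment p q y (fun t => ((q %| t - c)%Z : nat)%:Z) =
    q ^+ 2 * ((b y c 0%N)%:Z + (p - 1) * ((b y c 1%N)%:Z + p * (b y c 2)%:Z)).
  have -> : moment p q y (fun t => ((q %| t - c)%Z : nat)%:Z) =
     \sum_(k < 3) \sum_(l < 3) ramanujan p 0 k * ramanujan q 0 l * (b y c k)%:Z.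
    apply: eq_bigr => k _; apply: eq_bigr => l _.
    congr (_ * (nat_of_bool _)%:Z).
    exact: dvdz_shift (eigval_residue p q y (ltn_ord k) (ltn_ord l)) c.
  by rewrite !unroll /= /subgroup_sum /=; ring.
have bitsE c : b x c 1%N = b x' c 1%N /\ b x c 2 = b x' c 2.
  apply: (@bits_eq p) => //.
  have b0 : b x c 0%N = b x' c 0%N := dvdz_shift r0 c.
  have := eqM (fun t => ((q %| t - c)%Z : nat)%:Z); rewrite !momE b0.
  have q0 : q ^+ 2 != 0 by rewrite expf_neq0 //; lia.
  by move/(mulfI q0)/addrI; apply: mulfI; lia.
case=> [|[|[|//]]] // _.
- have [+ _] := bitsE (residue p x' 1).
  by rewrite /b subrr dvdz0.
- have [_] := bitsE (residue p x' 2%N).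
  by rewrite /b subrr dvdz0.
Qed.

(** The 3 by 3 matrix of the sums [ramanujan p k i] has determinant [p ^ 3] up to sign, so it is
    invertible modulo [q]. *)
Lemma col_diff_eq p q x x' : 1 < p -> 1 < q -> coprimez q p ->
  (forall f, moment p q x f = moment p q x' f) ->
  eigval p q x 0 0 = eigval p q x' 0 0 ->
  forall i, (i < 3)%N -> (q %| col_diff x i - col_diff x' i)%Z.
Proof.
move=> p1 q1 cop eqM eqdeg.
have res := residue_eq p1 q1 eqM eqdeg.
have := res 0%N isT; have := res 1%N isT; have := res 2%N isT.
rewrite /residue !unroll /= /subgroup_sum /=.
set d0 := col_diff x 0; set d1 := col_diff x 1; set d2 := col_diff x 2.
set e0 := col_diff x' 0; set e1 := col_diff x' 1; set e2 := col_diff x' 2.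
move=> r2 r1 r0.
have {}r0 : (q %| d2 - e2)%Z.
  rewrite -(Gauss_dvdzr _ (coprimezXr 2 cop)).
  by have := rpredB r0 r1; congr (dvdz _ _); ring.
have {}r1 : (q %| d1 - e1)%Z.
  rewrite -(Gauss_dvdzr _ cop).
  have := rpredD (rpredB r1 r2) (dvdz_mull p r0).
  by congr (dvdz _ _); ring.
case=> [|[|[|//]]] // _; have := rpredD r2 r1.
by congr (dvdz _ _); ring.
Qed.

(** * The third moment and the last column *)

Definition last_col (p : int) (x : nat -> nat -> int) (k : nat) : int :=
  \sum_(i < 3) x i 2%N * ramanujan p k i.

(** With [L := last_col p x k], the eigenvalues for a fixed [k] are [A + q (q - 1) L], [A - q L] and
    one free of [L], with weights 1, [q - 1], [q ^ 2 - q]. The terms linear in [L] cancel, leaving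
    [L ^ 2] and [L ^ 3]. *)
Lemma moment_cube_sub (p q : int) (x x' : nat -> nat -> int) :
  (forall i, (i < 3)%N -> x i 0%N = x' i 0%N /\ x i 1%N = x' i 1%N) ->
  moment p q x (fun t => t ^+ 3) - moment p q x' (fun t => t ^+ 3) =
  \sum_(k < 3) ramanujan p 0 k * (q ^+ 4 * (q - 1) * (q - 2) *
      (last_col p x k ^+ 3 - last_col p x' k ^+ 3)
    + 3 * q ^+ 3 * (q - 1) * (last_col p x k ^+ 2 - last_col p x' k ^+ 2) *
        \sum_(i < 3) ((x i 0%N + (q - 1) * x i 1%N) * ramanujan p k i)).
Proof.
move=> eqx; rewrite /moment -sumrB; apply: eq_bigr => k _.
pose A := \sum_(i < 3) ((x i 0%N + (q - 1) * x i 1%N) * ramanujan p k i).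
pose A' := \sum_(i < 3) ((x i 0%N - x i 1%N) * ramanujan p k i).
have eigvalE (y : nat -> nat -> int) :
    (forall i, (i < 3)%N -> y i 0%N = x i 0%N /\ y i 1%N = x i 1%N) ->
  [/\ eigval p q y k 0 = A + q * (q - 1) * last_col p y k,
      eigval p q y k 1 = A - q * last_col p y k & eigval p q y k 2 = A'].
  move=> eqy; have [e00 e01] := eqy 0%N isT; have [e10 e11] := eqy 1%N isT.
  have [e20 e21] := eqy 2%N isT; rewrite /eigval /last_col /A /A' !unroll /=.
  by rewrite e00 e01 e10 e11 e20 e21 /subgroup_sum /=; split; ring.
rewrite !unroll /=.
have [//|-> -> ->] := eigvalE x.
have [i /eqx[-> ->] //|-> -> ->] := eigvalE x'.
by rewrite /A /A' !unroll /= /subgroup_sum /=; ring.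
Qed.

Lemma dvdz_small (q a : int) : (q %| a)%Z -> - q < a < q -> a = 0.
Proof.
case/dvdzP=> m -> bnd.
have [?|[->|?]] : m <= -1 \/ m = 0 \/ 1 <= m by lia.
- by nia.
- by rewrite mul0r.
- by nia.
Qed.

(* B0, B1, B2 are the values of last_col 2 at k = 0, 1, 2, and the cubic relation
   is the difference of third moments left over when B0 and the squares agree. *)
Lemma cube_separates (a1 a2 a3 b1 b2 b3 : bool)
  (B0 := fun u v w : bool => (u%:Z + v%:Z + 2 * w%:Z)%R)
  (B1 := fun u v w : bool => (u%:Z + v%:Z - 2 * w%:Z)%R)
  (B2 := fun u v : bool => (u%:Z - v%:Z)%R) :
  B0 a1 a2 a3 = B0 b1 b2 b3 ->
  [/\ B1 a1 a2 a3 ^+ 2 = B1 b1 b2 b3 ^+ 2, B2 a1 a2 ^+ 2 = B2 b1 b2 ^+ 2 &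
      B1 a1 a2 a3 ^+ 3 - B1 b1 b2 b3 ^+ 3 + 2 * (B2 a1 a2 ^+ 3 - B2 b1 b2 ^+ 3) = 0
      -> [/\ a1 = b1, a2 = b2 & a3 = b3]].
Proof.
by rewrite /B0 /B1 /B2; case: a1; case: a2; case: a3; case: b1; case: b2;
  case: b3; move=> e; split; try done; vm_compute in e; try discriminate e;
  move=> c; vm_compute in c.
Qed.

(** [|s (p - 1) + t (q - 1)| < 2 (q - 1) <= (p - 1) (q - 1)] forces [r = 0]; then [p < q] forces
    [t = 0], and so [s = 0]. *)
Lemma degree_rigid (p q r s t : int) : 2 < p -> p < q ->
  -1 <= r <= 1 -> -1 <= s <= 1 -> -1 <= t <= 1 ->
  s * (p - 1) + t * (q - 1) + r * ((p - 1) * (q - 1)) = 0 ->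
  [/\ r = 0, s = 0 & t = 0].
Proof.
move=> p2 ltpq r1 s1 t1; set m := (p - 1) * (q - 1).
have : 2 * (q - 1) <= m by rewrite /m; nia.
move: m => m m_ge eq0.
have trit (a : int) : -1 <= a <= 1 -> [\/ a = -1, a = 0 | a = 1].
  move=> ?; have [?|[?|?]] : a = -1 \/ a = 0 \/ a = 1 by lia.
  - by constructor 1.
  - by constructor 2.
  - by constructor 3.
by case: (trit r r1) eq0 => ->; case: (trit s s1) => ->;
  case: (trit t t1) => -> eq0; split; lia.
Qed.

(** * Recovering the 0/1 matrix from its moments *)

Lemma moments_inj (p q : nat) (b b' : nat -> nat -> bool) :
  prime p -> prime q -> (p < q)%N -> b 0 0 = b' 0 0 ->
  (forall f : int -> int, moment p q b f = moment p q b' f) ->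
  forall i j, (i < 3)%N -> (j < 3)%N -> b i j = b' i j.
Proof.
move=> pp pq ltpq b00 eqM.
pose x i j : int := b i j; pose x' i j : int := b' i j.
have p1 : 1 < p%:Z by have := prime_gt1 pp; lia.
have q1 : 1 < q%:Z by lia.
have cop : coprimez q p.
  by rewrite coprimezE !absz_nat prime_coprime // gtnNdvd // prime_gt0.
have eqdeg : eigval p q x 0 0 = eigval p q x' 0 0.
  have sqrE (c : nat -> nat -> bool) :
      eigval p q (fun i j => (c i j)%:Z ^+ 2) 0 0 = eigval p q c 0 0.
    by apply: eq_bigr => i _; apply: eq_bigr => j _; case: (c i j).
  have := eqM (fun t => t ^+ 2); rewrite !moment_sqr !sqrE.
  by apply: mulfI; rewrite mulf_neq0 // expf_neq0 //; lia.
have colq := col_diff_eq p1 q1 cop eqM eqdeg.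
have rowp : forall j, (j < 3)%N ->
    (p %| x 0%N j - x 1%N j - (x' 0%N j - x' 1%N j))%Z.
  have eqMt f :
      moment q p (fun i j => x j i) f = moment q p (fun i j => x' j i) f.
    by rewrite (moment_transpose p q x) (moment_transpose p q x').
  have eqdt : eigval q p (fun i j => x j i) 0 0 = eigval q p (fun i j => x' j i) 0 0.
    by rewrite (eigval_transpose p q x) (eigval_transpose p q x').
  by rewrite coprimez_sym in cop; have := col_diff_eq q1 p1 cop eqMt eqdt.
have b01 i j : 0 <= x i j <= 1 /\ 0 <= x' i j <= 1.
  by rewrite /x /x'; case: (b i j); case: (b' i j).
have eq00 : x 0%N 0%N = x' 0%N 0%N by rewrite /x b00.
(* Two differences of bits are at most 2 apart, and [q > 2]. *)
have {colq} colq i : (i < 3)%N -> x i 0%N - x i 1%N = x' i 0%N - x' i 1%N.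
  move=> i3; apply/eqP; rewrite -subr_eq0; apply/eqP.
  apply: dvdz_small (colq i i3) _; rewrite /col_diff.
  by have := b01 i 0%N; have := b01 i 1%N; lia.
have c0 := colq 0%N isT; have c1 := colq 1%N isT; have c2 := colq 2%N isT.
suff eqx i j : (i < 3)%N -> (j < 3)%N -> x i j = x' i j.
  move=> i j i3 j3; have := eqx i j i3 j3; rewrite /x /x'.
  by case: (b i j); case: (b' i j).
suff [e10 e20 e02 e12 e22] : [/\ x 1 0 = x' 1 0, x 2 0 = x' 2 0,
    x 0 2 = x' 0 2, x 1 2 = x' 1 2 & x 2 2 = x' 2 2]%N.
  by case: i j => [|[|[|//]]] [|[|[|//]]] _ _; lia.
clear i j.
have B10 := b01 1%N 0%N; have B20 := b01 2%N 0%N; have B02 := b01 0%N 2%N.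
have B12 := b01 1%N 2%N; have B22 := b01 2%N 2%N.
(* Equality of degrees, divided by [q]: with column 1 eliminated, the first two columns have joint
   weight [1 + (q - 1) = q], the last one [q (q - 1)]. *)
have lin : (p%:Z - 1) * (x 1%N 0%N - x' 1%N 0%N)
    + p%:Z * (p%:Z - 1) * (x 2%N 0%N - x' 2%N 0%N)
    + (q%:Z - 1) * (x 0%N 2%N - x' 0%N 2%N + (p%:Z - 1) * (x 1%N 2%N - x' 1%N 2%N)
         + p%:Z * (p%:Z - 1) * (x 2%N 2%N - x' 2%N 2%N)) = 0.
  have q0 : q%:Z != 0 by lia.
  have e01 : x 0%N 1%N = x' 0%N 1%N by lia.
  have e11 : x 1%N 1%N = x 1%N 0%N - x' 1%N 0%N + x' 1%N 1%N by lia.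
  have e21 : x 2%N 1%N = x 2%N 0%N - x' 2%N 0%N + x' 2%N 1%N by lia.
  apply: (mulfI q0); rewrite mulr0; have := subrr (eigval p q x' 0 0).
  rewrite -{1}eqdeg => D0; rewrite -[RHS]D0 /eigval !unroll /= /subgroup_sum /=.
  by rewrite eq00 e01 e11 e21; ring.
case: (ltnP 2 p) => [p3 | p2].
  (* For [p > 2] the row differences agree exactly as well, and turn [lin] into [p] times the
     relation of [degree_rigid]. *)
  have {}rowp j : (j < 3)%N -> x 0%N j - x 1%N j = x' 0%N j - x' 1%N j.
    move=> j3; apply/eqP; rewrite -subr_eq0; apply/eqP.
    apply: dvdz_small (rowp j j3) _.
    by have := b01 0%N j; have := b01 1%N j; lia.
  have r0 := rowp 0%N isT; have r2 := rowp 2%N isT.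
  have e10 : x 1%N 0%N = x' 1%N 0%N by lia.
  have [||||||e22 e20 e02] := @degree_rigid p q (x 2%N 2%N - x' 2%N 2%N)
      (x 2%N 0%N - x' 2%N 0%N) (x 0%N 2%N - x' 0%N 2%N); try lia; last by split; lia.
  have e12 : x 1%N 2%N = x 0%N 2%N - x' 0%N 2%N + x' 1%N 2%N by lia.
  have p0 : p%:Z != 0 by lia.
  apply: (mulfI p0); rewrite mulr0 -[RHS]lin e10 e12; ring.
have {p2} p2 : p = 2%N by have := prime_gt1 pp; lia.
subst p; have [h qE] : exists h : nat, q = h.*2.+1.
  exists q./2; rewrite -[LHS]odd_double_half.
  by case: (even_prime pq) => [q2|->//]; rewrite q2 in ltpq.
have [m mE] := dvdzP (rowp 2%N isT).
have [e10 e20 w0] : [/\ x 1%N 0%N = x' 1%N 0%N, x 2%N 0%N = x' 2%N 0%N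
    & x 0%N 2%N - x' 0%N 2%N + (x 1%N 2%N - x' 1%N 2%N)
      + 2 * (x 2%N 2%N - x' 2%N 2%N) = 0].
  (* By parity of the row difference in column 2, the factor of [q - 1 = 2 h] in [lin] is [2 w]. The
     remaining terms have absolute value at most 3, so [4 h w] vanishes. *)
  pose w := m + (x 1%N 2%N - x' 1%N 2%N) + (x 2%N 2%N - x' 2%N 2%N).
  have {}lin : (x 1%N 0%N - x' 1%N 0%N) + 2 * (x 2%N 0%N - x' 2%N 0%N)
      + 4 * (h%:Z * w) = 0.
    rewrite /w; nia.
  have hw : h%:Z * w = 0 by lia.
  have {hw} : w = 0 by nia.
  rewrite /w => ?; split; lia.
have e0 : forall i, (i < 3)%N -> x i 0%N = x' i 0%N /\ x i 1%N = x' i 1%N.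
  by case=> [|[|[|//]]] _; split; lia.
have q3 : 3 <= q%:Z by lia.
have [|sq1 sq2 cub] := @cube_separates (b 0 2)%N (b 1 2)%N (b 2 2)%N
    (b' 0 2)%N (b' 1 2)%N (b' 2 2)%N.
  by move: w0; rewrite /x /x'; clear; lia.
suff [b02 b12 b22] : [/\ b 0 2 = b' 0 2, b 1 2 = b' 1 2 & b 2 2 = b' 2 2]%N.
  by rewrite /x /x' b02 b12 b22.
apply: cub.
have K0 : q%:Z ^+ 4 * (q%:Z - 1) * (q%:Z - 2) != 0.
  by clear -q3; rewrite !mulf_neq0 ?expf_neq0 //; lia.
apply: (mulfI K0); rewrite mulr0.
have := moment_cube_sub 2 q e0; rewrite (eqM (fun t => t ^+ 3)) subrr.
have B0E : last_col 2 x 0%N = last_col 2 x' 0%N.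
  by apply: subr0_eq; rewrite -[RHS]w0 /last_col !unroll /= /subgroup_sum /=; ring.
have lvl1E (c : nat -> nat -> bool) :
    last_col 2 c 1%N = (c 0 2)%N%:Z + (c 1 2)%N%:Z - 2 * (c 2 2)%N%:Z.
  by rewrite /last_col !unroll /= /subgroup_sum /=; ring.
have lvl2E (c : nat -> nat -> bool) :
    last_col 2 c 2%N = (c 0 2)%N%:Z - (c 1 2)%N%:Z.
  by rewrite /last_col !unroll /= /subgroup_sum /=; ring.
(* The term [k = 0] drops out; [k = 1] and [k = 2] have weights 1 and 2, whence the factor 2 in the
   cubic relation. *)
rewrite 3!big_ord_recl big_ord0 /= B0E.
rewrite -/x -/x' !lvl1E !lvl2E sq1 sq2 => E; rewrite [RHS]E.
by rewrite /subgroup_sum /=; ring.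
Qed.

(** * Diagonalization of a circulant graph by characters *)

Lemma char_poly_diagonalized (F : fieldType) n (A P : 'M[F]_n) (d : 'rV_n) :
  P \in unitmx -> A *m P = P *m diag_mx d ->
  char_poly A = \prod_i ('X - (d 0 i)%:P).
Proof.
move=> Pu AP.
have detP : \det (map_mx polyC P) != 0.
  by rewrite det_map_mx polyC_eq0 -unitfE -unitmxE.
have eqM : char_poly_mx A *m map_mx polyC P =
    map_mx polyC P *m char_poly_mx (diag_mx d).
  rewrite /char_poly_mx mulmxBl mulmxBr -!map_mxM AP.
  by rewrite mul_scalar_mx mul_mx_scalar.
have := congr1 determinant eqM; rewrite !det_mulmx [RHS]mulrC => /(mulIf detP).
rewrite -/(char_poly A) -/(char_poly (diag_mx d)) => ->.
rewrite char_poly_trig ?diag_mx_is_trig //.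
by apply: eq_bigr => i _; rewrite mxE eqxx.
Qed.

Definition icg_eigenvalue (N : nat) (D : {fset nat}) (z : algC) (j : nat) : algC :=
  \sum_(m < N) (gcdn m N \in D)%:R * z ^+ (j * m).

Lemma spectrum_icg N D (z : algC) : N.-primitive_root z ->
  perm_eq (spectrum (icg N D))
    [seq icg_eigenvalue N D z (nat_of_ord j) | j : 'I_N].
Proof.
move=> zN; have := prim_order_gt0 zN; case: N zN => // n zN _.
rewrite /spectrum /eigenvalues; case: closed_field_poly_normal => r /= rE.
rewrite (perm_trans (perm_eq_seq_mset _)) //; apply: prod_XsubC_eq.
rewrite (monicP (char_poly_monic _)) scale1r in rE.
rewrite -rE big_map enumT.
(* Column [j] of [P] is the character [i |-> z ^ (j * i)], an eigenvector. *)
pose P := Vandermonde n.+1 (\row_(j < n.+1) z ^+ j).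
pose d := \row_(j < n.+1) icg_eigenvalue n.+1 D z j.
rewrite (@char_poly_diagonalized _ _ _ P d).
- by apply: eq_bigr => i _; rewrite mxE.
- rewrite unitmxE unitfE det_Vandermonde.
  apply/prodf_neq0 => i _; apply/prodf_neq0 => j ltij.
  rewrite !mxE subr_eq0 (eq_prim_root_expr zN) !modn_small //.
  by rewrite neq_ltn ltij orbT.
apply/matrixP=> i j; rewrite mul_mx_diag !mxE mulr_sumr.
(* Neighbours of [i] are written [i + m]; on wrapping around, the difference becomes [n.+1 - m],
   which has the same gcd with [n.+1]. *)
rewrite (reindex_inj (addrI i)); apply: eq_bigr => m _.
rewrite !mxE -!exprM mulrCA -exprD -mulnDr; congr (_ * _).
  rewrite /icg /=; congr (_ \in D)%:R.
  have := ltn_ord i; have := ltn_ord m;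
  move: (nat_of_ord i) (nat_of_ord m) => {i j m} i m lm li.
  have [le|gt] := ltnP (i + m) n.+1.
    by rewrite modn_small //; congr gcdn; lia.
  have -> : ((i + m) %% n.+1 = i + m - n.+1)%N.
    by rewrite -[in LHS](subnK gt) modnDr modn_small //; lia.
  have -> : absz (i%:Z - (i + m - n.+1)%N%:Z) = (n.+1 - m)%N by lia.
  have := subnK (ltnW lm); move: (n.+1 - m)%N => t <-.
  by rewrite gcdnDl gcdnDr gcdnC.
by rewrite /= -(prim_expr_mod zN) modnMmr (prim_expr_mod zN).
Qed.

(** * Character sums over divisibility classes *)

Lemma sum_multiples (R : nmodType) (F : nat -> R) (e c : nat) : (0 < e)%N ->
  \sum_(m < e * c | (e %| m)%N) F m = \sum_(t < c) F (e * t)%N.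
Proof.
move=> e0; rewrite -(big_mkord (fun m => (e %| m)%N)).
elim: c => [|c IH]; first by rewrite muln0 big_nil big_ord0.
rewrite big_ord_recr /= -IH mulnS addnC (@big_cat_nat _ _ _ (e * c)) ?leq_addr //=.
congr (_ + _); rewrite -{1}[(e * c)%N]add0n big_addn addKn.
case: e e0 {IH} => // e _; rewrite big_mkcond big_nat_recl //= add0n dvdn_mulr //.
rewrite big1_seq ?addr0 // => i; rewrite mem_index_iota => /andP[_ ltie].
by rewrite dvdn_addl ?dvdn_mulr // gtnNdvd.
Qed.

(** A geometric series in [z ^ (j * e)], a [c]-th root of unity that is 1 exactly when [c] divides
    [j]. *)
Lemma sum_prim_root_multiples (F : fieldType) (z : F) (e c j : nat) :
  (e * c).-primitive_root z ->
  \sum_(m < e * c | (e %| m)%N) z ^+ (j * m) = (if (c %| j)%N then c else 0%N)%:R.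
Proof.
move=> zN; have := prim_order_gt0 zN; rewrite muln_gt0 => /andP[e0 c0].
rewrite (sum_multiples (fun m => z ^+ (j * m))) //.
under eq_bigr do rewrite mulnA exprM.
have we : (z ^+ (j * e) == 1) = (c %| j)%N.
  by rewrite -(prim_order_dvd zN) mulnC dvdn_pmul2r.
rewrite -we; case: eqP => [->|/eqP w1].
  by under eq_bigr do rewrite expr1n; rewrite sumr_const card_ord.
have := subrX1 (z ^+ (j * e)) c; rewrite -exprM -mulnA mulnC exprM (prim_expr_order zN).
rewrite expr1n subrr => /esym/eqP.
by rewrite mulf_eq0 subr_eq0 (negPf w1) => /eqP.
Qed.

(* z ^+ (j * m), for z of order p^2 q^2, restricts to a character of order
   p^(cls p j) on the p-primary part; equally m has order p^(cls p m) there. *)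
Definition cls (p m : nat) : nat :=
  if (p ^ 2 %| m)%N then 0 else if (p %| m)%N then 1 else 2.

Lemma cls_lt3 p m : (cls p m < 3)%N.
Proof. by rewrite /cls; case: ifP => // _; case: ifP. Qed.

Lemma dvdn_cls p m k : (k < 3)%N -> (p ^ k %| m)%N = (cls p m + k <= 2)%N.
Proof.
have p2 : (p ^ 2 %| m -> p %| m)%N by apply: dvdn_trans; rewrite expnS dvdn_mulr.
rewrite /cls; case: k => [|[|[|//]]] _; rewrite ?expn0 ?expn1 ?dvd1n ?addn0.
- by case: ifP => // _; case: ifP.
- by case: ifP => [/p2 ->|_] //; case: ifP.
- by case: ifP => // _; case: ifP.
Qed.

Lemma cls_eqE (R : pzRingType) p m k : (k < 3)%N -> (cls p m == k)%:R =
  (p ^ (2 - k) %| m)%N%:R - (if k is k'.+1 then (p ^ (2 - k') %| m)%N%:R else 0) :> R.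
Proof.
case: k => [|[|[|//]]] _; rewrite !dvdn_cls //; move: (cls_lt3 p m);
  by case: (cls p m) => [|[|[|//]]] _ /=; rewrite ?subr0 ?subrr.
Qed.

Lemma gcdn_cls p m : prime p -> gcdn m (p ^ 2) = (p ^ (2 - cls p m))%N.
Proof.
move=> pp; have /(dvdn_pfactor _ _ pp)[k k2 gE] := dvdn_gcdr m (p ^ 2).
rewrite gE; congr (_ ^ _)%N; have c3 := cls_lt3 p m.
have := @dvdn_gcd (p ^ (2 - cls p m)) m (p ^ 2).
rewrite gE !dvdn_Pexp2l ?prime_gt1 // dvdn_cls ?ltnS ?leq_subr //.
have : (p ^ k %| m)%N by rewrite -gE dvdn_gcdl.
by rewrite dvdn_cls //; lia.
Qed.

Section TwoPrimes.

Variables (p q : nat) (pp : prime p) (pq : prime q) (ltpq : (p < q)%N).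
Let N := (p ^ 2 * q ^ 2)%N.

Let coXX a b : coprime (p ^ a) (q ^ b).
Proof.
by rewrite coprimeXl ?coprimeXr // prime_coprime // dvdn_prime2 // neq_ltn ltpq.
Qed.

Lemma gcdn_cls2 m : gcdn m N = (p ^ (2 - cls p m) * q ^ (2 - cls q m))%N.
Proof.
rewrite -!gcdn_cls //; apply/eqP; rewrite eqn_dvd; apply/andP; split; last first.
  rewrite Gauss_dvd; last first.
    exact: coprime_dvdl (dvdn_gcdr _ _) (coprime_dvdr (dvdn_gcdr _ _) (coXX 2 2)).
  rewrite !dvdn_gcd !dvdn_gcdl /= (dvdn_trans (dvdn_gcdr _ _) (dvdn_mulr _ (dvdnn _))).
  by rewrite (dvdn_trans (dvdn_gcdr _ _) (dvdn_mull _ (dvdnn _))).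
rewrite muln_gcdl !muln_gcdr !dvdn_gcd dvdn_gcdr.
by rewrite ![(gcdn _ _ %| m * _)%N]dvdn_mulr ?dvdn_gcdl // dvdn_mull ?dvdn_gcdl.
Qed.

(** Inclusion-exclusion at each prime reduces this to sums over subgroups of order [p ^ a * q ^ b],
    the multiples of [p ^ (2 - a) * q ^ (2 - b)]. *)
Lemma sum_cls (F : fieldType) (z : F) (j k l : nat) : N.-primitive_root z ->
  (k < 3)%N -> (l < 3)%N ->
  \sum_(m < N) (cls p m == k)%:R * (cls q m == l)%:R * z ^+ (j * m) =
  (ramanujan p (cls p j) k * ramanujan q (cls q j) l)%:~R.
Proof.
move=> zN k3 l3.
have multE a b : (a < 3)%N -> (b < 3)%N ->
    \sum_(m < N) (p ^ (2 - a) %| m)%N%:R * (q ^ (2 - b) %| m)%N%:R * z ^+ (j * m)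
    = (subgroup_sum p (cls p j) a)%:~R * (subgroup_sum q (cls q j) b)%:~R.
  move=> a3 b3; pose e := (p ^ (2 - a) * q ^ (2 - b))%N.
  have NE : N = (e * (p ^ a * q ^ b))%N.
    by rewrite /N /e mulnACA -!expnD !subnK.
  transitivity (\sum_(m < N | (e %| m)%N) z ^+ (j * m)).
    rewrite [RHS]big_mkcond; apply: eq_bigr => m _.
    by rewrite Gauss_dvd //; do 2!case: (_ %| _)%N; rewrite ?mul1r ?mul0r.
  rewrite NE in zN *; rewrite sum_prim_root_multiples // Gauss_dvd // !dvdn_cls //.
  rewrite /subgroup_sum; case: (_ <= 2)%N; case: (_ <= 2)%N;
    rewrite /= ?mul0r ?mulr0 //.
  by rewrite natrM !natrX !rmorphXn.
have ram0 p' c : (c < 3)%N -> ramanujan p' c 0 = subgroup_sum p' c 0.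
  by move=> c3; rewrite /= /subgroup_sum addn0 -ltnS c3.
under eq_bigr do rewrite !cls_eqE //.
case: k k3 => [|k] k3; case: l l3 => [|l] l3; rewrite ?ram0 ?cls_lt3 //=;
  under eq_bigr do rewrite ?subr0 ?mulrBr ?mulrBl ?mulrBr ?mulrBl;
  rewrite ?sumrB ?multE ?(ltnW k3) ?(ltnW l3) //;
  rewrite rmorphM ?rmorphB /=; ring.
Qed.

Lemma sum_by_cls (F : fieldType) (z : F) (j : nat) (g : nat -> nat -> F) :
  N.-primitive_root z ->
  \sum_(m < N) g (cls p m) (cls q m) * z ^+ (j * m) =
  \sum_(k < 3) \sum_(l < 3) g k l * (ramanujan p (cls p j) k * ramanujan q (cls q j) l)%:~R.
Proof.
move=> zN; under [RHS]eq_bigr do under eq_bigr do rewrite -(sum_cls _ zN) // mulr_sumr.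
under [RHS]eq_bigr do rewrite exchange_big.
rewrite [RHS]exchange_big; apply: eq_bigr => m _.
rewrite (bigD1 (Ordinal (cls_lt3 p m))) //= (bigD1 (Ordinal (cls_lt3 q m))) //=.
rewrite !eqxx !mul1r !big1 ?addr0 // => [k kne|l lne].
  apply: big1 => l _; rewrite [_ == _ :> nat]eq_sym (_ : (_ == _ :> nat) = false)
    ?mul0r ?mulr0 //.
  exact: negPf.
rewrite [cls q m == l]eq_sym (_ : (nat_of_ord l == _) = false) ?mulr0 ?mul0r ?mulr0 //.
exact: negPf.
Qed.

(** The indices record the order [p ^ i * q ^ l] of a vertex difference, so (0, 0) stands for the
    divisor [N]. *)
Definition symbol_indicator (D : {fset nat}) (i l : nat) : bool :=
  (p ^ (2 - i) * q ^ (2 - l))%N \in D.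

Lemma icg_eigenvalueE D (z : algC) j : N.-primitive_root z ->
  icg_eigenvalue N D z j =
  (eigval p q (symbol_indicator D) (cls p j) (cls q j))%:~R.
Proof.
move=> zN; rewrite /icg_eigenvalue.
under eq_bigr do rewrite gcdn_cls2.
rewrite (sum_by_cls j (fun k l => (symbol_indicator D k l)%:R) zN) /eigval rmorph_sum.
apply: eq_bigr => k _; rewrite rmorph_sum; apply: eq_bigr => l _.
by rewrite rmorphM.
Qed.

Lemma moment_spectrum D (z : algC) f : N.-primitive_root z ->
  moment p q (symbol_indicator D) f =
  \sum_(j < N) f (eigval p q (symbol_indicator D) (cls p j) (cls q j)).
Proof.
move=> zN; apply: (@intr_inj algC).
pose g k l : algC := (f (eigval p q (symbol_indicator D) k l))%:~R.
(* At [j = 0] all powers of [z] are 1 and the Ramanujan sums are class sizes. *)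
have := sum_by_cls 0 g zN.
under eq_bigr do rewrite mul0n expr0 mulr1.
move=> momE; rewrite [RHS]rmorph_sum momE /moment rmorph_sum; apply: eq_bigr => k _.
rewrite rmorph_sum; apply: eq_bigr => l _.
by rewrite /cls !dvdn0 mulrC -rmorphM.
Qed.

(** The eigenvalues are integers, so equality of spectra descends from [algC] to [int], where [f]
    applies. *)
Lemma moment_isospectral D D' : spectrum (icg N D) = spectrum (icg N D') ->
  forall f,
  moment p q (symbol_indicator D) f = moment p q (symbol_indicator D') f.
Proof.
move=> eqS f; have N0 : (0 < N)%N by rewrite muln_gt0 !expn_gt0 !prime_gt0.
have [z zN] := C_prim_root_exists N0.
rewrite !(moment_spectrum _ _ zN).
pose ev C (j : 'I_N) := eigval p q (symbol_indicator C) (cls p j) (cls q j).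
have evP C : perm_eq (spectrum (icg N C)) (map intr (map (ev C) (enum 'I_N))).
  have evE : (fun j : 'I_N => icg_eigenvalue N C z j) =1 intr \o ev C.
    by move=> j; apply: icg_eigenvalueE.
  by rewrite -map_comp -(eq_map evE); apply: spectrum_icg.
have evE : perm_eq (map (ev D) (enum 'I_N)) (map (ev D') (enum 'I_N)).
  apply: (perm_map_inj (@intr_inj algC)).
  by apply: perm_trans (evP D'); rewrite perm_sym -eqS.
by have := perm_big (op := +%R) (x := 0) _ (F := f) (P := xpredT) evE;
  rewrite !big_map.
Qed.

End TwoPrimes.

Local Close Scope ring_scope.

Theorem theorem7p4 (N p q : nat) (hp : prime p) (hq : prime q) (hpq : p < q)
  (hN : N = p ^ 2 * q ^ 2) : ISAP N.
Proof.
subst N => D D' symD symD'; split=> [eqS|-> //].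
have N_notin (C : {fset nat}) : integral_symbol (p ^ 2 * q ^ 2) C ->
    symbol_indicator p q C 0 0 = false.
  by move=> symC; apply/negP => /symC[_]; rewrite ltnn andbF.
have eqI := moments_inj hp hq hpq
  (etrans (N_notin D symD) (esym (N_notin D' symD'))) (moment_isospectral hp hq hpq eqS).
(* A divisor [d] equals its gcd with [p ^ 2 * q ^ 2], which depends only on its two classes. *)
have memE (C : {fset nat}) d : integral_symbol (p ^ 2 * q ^ 2) C ->
    (d \in C) = (d %| p ^ 2 * q ^ 2) && symbol_indicator p q C (cls p d) (cls q d).
  move=> symC; rewrite /symbol_indicator -gcdn_cls2 //.
  have [/gcdn_idPl->//|/negP ndvd] := boolP (d %| _).
  by apply/negP => /symC[].
by apply/fsetP => d; rewrite (memE D) // (memE D') // eqI ?cls_lt3.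
Qed.
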